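(* Let $V$ be a finite set with a topology $\mathcal D$, and for each $v\in V$ let $\Omega_v$ be a nonempty preordered set. For $U\in\mathcal D$ let $\Theta U$ be the set of $U$-traces and let $\Theta_{\mathrm{tot}}\defeq\coprod_{U\in\mathcal D}\Theta U$, with $d:\Theta_{\mathrm{tot}}\to\mathcal D$ the map $(U,x)\mapsto U$ and, for $x\in\Theta_{\mathrm{tot}}$ and $U\subseteq d x$, $x_{\downarrow U}\defeq x|_U$ (restriction of traces). Then $(\Theta_{\mathrm{tot}},\mathcal D,d,\downarrow)$ is a tuple system over the lattice $(\mathcal D,\subseteq)$ (with meet $\cap$ and join $\cup$), i.e. for all $x,y\in\Theta_{\mathrm{tot}}$ and $U,W\in\mathcal D$: (T1) if $U\subseteq dx$ then $d(x_{\downarrow U})=U$; (T2) if $W\subseteq U\subseteq dx$ then $(x_{\downarrow U})_{\downarrow W}=x_{\downarrow W}$; (T3) if $dx=U$ then $x_{\downarrow U}=x$; (T4) if $U=dx$, $W=dy$ and $x_{\downarrow U\cap W}=y_{\downarrow U\cap W}$, then there exists $z$ with $dz=U\cup W$, $z_{\downarrow U}=x$ and $z_{\downarrow W}=y$; (T5) if $dx=U$ and $U\subseteq W$, then there exists $y$ with $dy=W$ and $y_{\downarrow U}=x$.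
   Context: For $U\in\mathcal D$, $\Omega U\defeq\prod_{v\in U}\Omega_v$ with the componentwise preorder (so $\Omega\emptyset$ is a one-point set). For $n\ge -1$, a $U$-trace of length $n$ is a sequence $x_0\le x_1\le\dots\le x_n$ of elements of $\Omega U$ (the empty sequence when $n=-1$) such that $x_i\ne x_{i+1}$ for all $0\le i<n$ (no repeated adjacent elements). $\Theta U$ is the set of all $U$-traces. For $U\subseteq U'$ in $\mathcal D$ and $x\in\Theta U'$, the restriction $x|_U\in\Theta U$ is obtained by projecting each $x_i$ onto the coordinates in $U$ and then collapsing every maximal run of consecutive equal entries to a single entry. (Equivalently, $\Theta$ is the composite of the frame functor $U\mapsto\Omega U$, the augmented simplicial nerve, and the functor taking nondegenerate cells.) *)

(* Defs.v *)
From HB Require Import structures.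
From mathcomp Require Import all_boot all_order.
From mathcomp Require Import boolp classical_sets cardinality topology.
Set Implicit Arguments.
Unset Strict Implicit.
Unset Printing Implicit Defensive.
Import Order.TTheory.
Local Open Scope classical_set_scope.
Local Open Scope order_scope.

(* A restriction [res x U] is defined only for [U <= d x], hence takes a proof
   of it. As [U <= d x] is a boolean, this proof is unique; the axioms
   quantify over every such proof needed to write them. In [tuple_res_res] the
   proof [hW'] always exists, by [tuple_dom_res] and [W <= U]. *)
Record tuple_system (disp : Order.disp_t) (L : latticeType disp) (T : Type)
    (d : T -> L) (res : forall (x : T) (U : L), U <= d x -> T) : Prop :=
  TupleSystem {
    tuple_dom_res : forall (x : T) (U : L) (hU : U <= d x), d (res x U hU) = U;
    tuple_res_res : forall (x : T) (U W : L), W <= U ->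
      forall (hU : U <= d x) (hW : W <= d x) (hW' : W <= d (res x U hU)),
        res (res x U hU) W hW' = res x W hW;
    tuple_res_id : forall (x : T) (U : L), d x = U ->
      forall hU : U <= d x, res x U hU = x;
    tuple_glue : forall (x y : T) (U W : L), U = d x -> W = d y ->
      forall (hx : U `&` W <= d x) (hy : U `&` W <= d y),
        res x (U `&` W) hx = res y (U `&` W) hy ->
        exists (z : T) (hU : U <= d z) (hW : W <= d z),
          [/\ d z = U `|` W, res z U hU = x & res z W hW = y];
    tuple_extend : forall (x : T) (U W : L), d x = U -> U <= W ->
      exists (y : T) (hU : U <= d y), d y = W /\ res y U hU = x
  }.
Arguments tuple_system {disp L T} d res.

Section Opens.
Variable V : topologicalType.

Definition is_open : {pred set V} := [pred U : set V | `[< open U >]].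

Record opens := Opens { open_set :> set V; _ : is_open open_set }.

HB.instance Definition _ := [isSub for open_set].
HB.instance Definition _ := [Choice of opens by <:].

Fact is_open_meet : Order.ClosedPredicates.meet_closed is_open.
Proof.
move=> A B /asboolP oA /asboolP oB; apply/asboolP.
exact: (openI oA oB).
Qed.

Fact is_open_join : Order.ClosedPredicates.join_closed is_open.
Proof.
move=> A B /asboolP oA /asboolP oB; apply/asboolP.
exact: (openU oA oB).
Qed.

HB.instance Definition _ := Order.SubChoice_isSubLattice.Build
  _ _ _ set_display opens is_open_meet is_open_join.

Lemma opens_leP (U W : opens) : reflect (open_set U `<=` open_set W) (U <= W).
Proof. by rewrite -Order.le_val; exact: subsetPset. Qed.

Lemma opens_meetE (U W : opens) :
  open_set (U `&` W) = (open_set U `&` open_set W)%classic.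
Proof. by []. Qed.

Lemma opens_joinE (U W : opens) :
  open_set (U `|` W) = (open_set U `|` open_set W)%classic.
Proof. by []. Qed.

End Opens.

Section Collapse.
Variable T : eqType.

Fixpoint collapse (s : seq T) : seq T :=
  match s with
  | x :: ((y :: _) as s') => if x == y then collapse s' else x :: collapse s'
  | _ => s
  end.

Lemma collapse_consE (x : T) s : exists s', collapse (x :: s) = x :: s'.
Proof.
elim: s x => [|y s IHs] x /=; first by exists [::].
by case: eqP => [->|_]; [exact: IHs | eexists].
Qed.

Lemma collapse_subseq s : subseq (collapse s) s.
Proof.
elim: s => [|x [|y s] IHs] //=; first by rewrite eqxx.
case: eqP => [->|_]; last by rewrite eqxx.
by rewrite -/(collapse (y :: s)); apply: subseq_trans IHs (subseq_cons _ _).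
Qed.

Lemma collapse_neq s : sorted (fun x y => x != y) (collapse s).
Proof.
elim: s => [|x [|y s] IHs] //.
rewrite [collapse _]/= -/(collapse (y :: s)); case: eqP => [//|/eqP xy].
by have [s' Es'] := collapse_consE y s; move: IHs; rewrite Es' /= xy.
Qed.

End Collapse.

Section Traces.
Variables (V : topologicalType) (disp : Order.disp_t).
Variable Omega : V -> preorderType disp.

(* [frame U] is the product of the [Omega v] over [v] in [U], the set [U] being
   coerced to the type [{v | v \in U}]. *)
Definition frame (U : set V) : Type := forall v : U, Omega (val v).

HB.instance Definition _ (U : set V) :=
  Choice.copy (frame U) (forall v : U, Omega (val v)).

Definition frame_le (U : set V) : rel (frame U) :=
  fun x y => `[< forall v : U, x v <= y v >].

Fact frame_le_refl U : reflexive (@frame_le U).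
Proof. by move=> x; apply/asboolP => v. Qed.

Fact frame_le_trans U : transitive (@frame_le U).
Proof.
move=> y x z /asboolP xy /asboolP yz; apply/asboolP => v.
exact: le_trans (xy v) (yz v).
Qed.

HB.instance Definition _ (U : set V) := Order.Le_isPreorder.Build disp (frame U)
  (@frame_le_refl U) (@frame_le_trans U).

Definition frame_proj (U U' : set V) (sUU' : U `<=` U') (x : frame U') :
    frame U :=
  fun v => x (exist _ (val v) (mem_set (sUU' _ (set_mem (valP v))))).

(* [Omega v] is only preordered, so distinct adjacent entries of a trace may
   still be equivalent: [<=] and [!=] do not amount to the strict relation
   [<], which for a preorder is [x <= y] and not [y <= x]. *)
Definition is_trace (U : set V) (s : seq (frame U)) : bool :=
  sorted <=%O s && sorted (fun x y => x != y) s.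

Record trace (U : set V) :=
  Trace { trace_seq :> seq (frame U); _ : is_trace trace_seq }.

HB.instance Definition _ (U : set V) := [isSub for @trace_seq U].

Fact trace_res_subproof (U U' : set V) (sUU' : U `<=` U') (x : trace U') :
  is_trace (collapse (map (frame_proj sUU') x)).
Proof.
rewrite /is_trace collapse_neq andbT.
apply: subseq_sorted (collapse_subseq _) _; first exact: le_trans.
case: x => s /= /andP[s_le _]; apply: homo_sorted s_le => x y /asboolP xy.
by apply/asboolP => v; exact: xy.
Qed.

Definition trace_res (U U' : set V) (sUU' : U `<=` U') (x : trace U') :
    trace U :=
  Trace (trace_res_subproof sUU' x).

Definition trace_tot : Type := {U : opens V & trace U}.

Definition trace_dom (x : trace_tot) : opens V := projT1 x.

Definition trace_tot_res (x : trace_tot) (U : opens V) (hU : U <= trace_dom x) :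
    trace_tot :=
  existT (fun U : opens V => trace U) U
    (trace_res (elimT (opens_leP U (trace_dom x)) hU) (projT2 x)).

End Traces.

(* Main.v *)
(* Gluing x and y amounts to interleaving them: both traverse the same list of
   distinct values over the intersection, so one can advance x and y separately
   while the common value stays fixed and simultaneously when it changes. The
   visited pairs agree on the intersection, hence glue to a monotone sequence
   over the union, whose collapse is the required trace since collapsing
   commutes with projecting. *)
Require Import Defs.
From HB Require Import structures.
From mathcomp Require Import all_boot all_order.
From mathcomp Require Import boolp classical_sets cardinality topology.
From Stdlib Require Import Eqdep_dec.
Set Implicit Arguments.
Unset Strict Implicit.
Unset Printing Implicit Defensive.
Import Order.TTheory.
Local Open Scope classical_set_scope.

(** * Collapsing runs of equal adjacent entries *)

Lemma collapse_cons2 (T : eqType) (x y : T) s :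
  collapse (x :: y :: s) =
  if x == y then collapse (y :: s) else x :: collapse (y :: s).
Proof. by []. Qed.

Lemma collapse_id (T : eqType) (s : seq T) :
  sorted (fun x y => x != y) s -> collapse s = s.
Proof.
elim: s => [//|x [//|y s] IHs] /andP[/negPf xy ys].
by rewrite collapse_cons2 xy IHs.
Qed.

(** Equal adjacent entries have equal images, so merging them before applying [f] only anticipates a
    merge that happens afterwards anyway. This makes restriction of traces functorial and lets it
    see through the collapse in a glued trace. *)
Lemma collapse_map_collapse (T T' : eqType) (f : T -> T') (s : seq T) :
  collapse (map f (collapse s)) = collapse (map f s).
Proof.
elim: s => [//|x [//|y s] IHs]; rewrite collapse_cons2.
case: eqP => [->|_]; first by rewrite IHs /= eqxx.
(* The collapsed tail still starts with [y], so both sides make the same test [f x == f y]. *)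
have [s' Es'] := collapse_consE y s.
by move: IHs; rewrite Es' !map_cons !collapse_cons2 => ->.
Qed.

(** * Synchronising two sequences over a common image *)

Section Interleave.
Variables (X Y Z : eqType) (f : X -> Z) (g : Y -> Z) (rX : rel X) (rY : rel Y).
Hypotheses (rXx : reflexive rX) (rYy : reflexive rY).

Let r (p q : X * Y) := rX p.1 q.1 && rY p.2 q.2.
Let E (p : X * Y) := f p.1 == g p.2.

(** Induction on the total length of the tails, with the current pair [(a, b)] explicit. The
    components are recovered only up to [collapse], because a sequence that waits for the other
    repeats its entry. *)
Lemma interleave_cons a s b t : path rX a s -> path rY b t ->
    collapse (map f (a :: s)) = collapse (map g (b :: t)) ->
  exists p, [/\ path r (a, b) p, all E ((a, b) :: p),
    collapse (a :: map fst p) = collapse (a :: s) &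
    collapse (b :: map snd p) = collapse (b :: t)].
Proof.
have [n] := ubnP (size s + size t).
elim: n a s b t => // n IHn a s b t /ltnSE le_n as_ bt st.
(* Collapsing preserves the head. *)
have Eab : f a = g b.
  by move: st; rewrite !map_cons; have [? ->] := collapse_consE (f a) (map f s);
     have [? ->] := collapse_consE (g b) (map g t) => -[].
(* If the next entry on the left has the same image, only the left advances: [b] waits, which
   reflexivity of [rY] allows, and the collapsed images are unchanged. *)
have [[a' [s' [Es fa']]]|sN] :=
  pselect (exists a' s', s = a' :: s' /\ f a = f a').
  move: as_ st le_n; rewrite {}Es !map_cons collapse_cons2 fa' eqxx.
  move=> /andP[aa' as'] st le_n.
  have [p [pr pE p1 p2]] := IHn a' s' b t le_n as' bt st.
  exists ((a', b) :: p); split.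
  - by rewrite /= pr andbT /r /= aa' rYy.
  - by rewrite /= [X in X && _]/E /= Eab eqxx.
  - by rewrite map_cons !collapse_cons2 p1.
  - by rewrite map_cons collapse_cons2 eqxx.
have [[b' [t' [Et gb']]]|tN] :=
  pselect (exists b' t', t = b' :: t' /\ g b = g b').
  move: bt st le_n; rewrite {}Et !map_cons (collapse_cons2 (g b)) gb' eqxx.
  move=> /andP[bb' bt'] st; rewrite addnS => le_n.
  have [p [pr pE p1 p2]] := IHn a s b' t' le_n as_ bt' st.
  exists ((a, b') :: p); split.
  - by rewrite /= pr andbT /r /= bb' rXx.
  - by rewrite /= [X in X && _]/E /= Eab eqxx.
  - by rewrite map_cons collapse_cons2 eqxx.
  - by rewrite map_cons !collapse_cons2 p2.
(* Neither side can advance alone, so any next entry changes the image. If just one side were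
   exhausted, a one-entry collapse would equal a longer one; so either both stop or both advance, to
   the same new image. *)
case: s t sN tN as_ bt st le_n => [|a' s'] [|b' t'] sN tN as_ bt.
- by move=> _ _; exists [::]; split=> //=; rewrite /E /= Eab eqxx.
- rewrite !map_cons (collapse_cons2 (g b)); case: eqP => [gb|_].
    by case: tN; exists b', t'.
  by have [? ->] := collapse_consE (g b') (map g t').
- rewrite !map_cons (collapse_cons2 (f a)); case: eqP => [fa|_].
    by case: sN; exists a', s'.
  by have [? ->] := collapse_consE (f a') (map f s').
- rewrite !map_cons (collapse_cons2 (f a)) (collapse_cons2 (g b)).
  case: eqP => [fa|_]; first by case: sN; exists a', s'.
  case: eqP => [gb|_]; first by case: tN; exists b', t'.
  case/andP: as_ => aa' as'; case/andP: bt => bb' bt'.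
  case=> _ st le_n.
  have {}le_n : size s' + size t' < n.
    by apply: ltnW; move: le_n; rewrite /= addnS.
  have [p [pr pE p1 p2]] := IHn a' s' b' t' le_n as' bt' st.
  exists ((a', b') :: p); split.
  - by rewrite /= pr andbT /r /= aa'.
  - by rewrite /= [X in X && _]/E /= Eab eqxx.
  - by rewrite map_cons !collapse_cons2 p1.
  - by rewrite map_cons !collapse_cons2 p2.
Qed.

Lemma interleave s t : sorted rX s -> sorted rY t ->
    collapse (map f s) = collapse (map g t) ->
  exists p, [/\ sorted r p, all E p,
    collapse (map fst p) = collapse s & collapse (map snd p) = collapse t].
Proof.
case: s t => [|a s] [|b t] //.
- by move=> _ _ _; exists [::].
- by move=> _ _; rewrite map_cons; have [? ->] := collapse_consE (g b) (map g t).
- by move=> _ _; rewrite map_cons; have [? ->] := collapse_consE (f a) (map f s).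
- move=> /interleave_cons/[apply]/[apply] -[p [? ? ? ?]].
  by exists ((a, b) :: p).
Qed.

End Interleave.

(** * Projecting, gluing and extending frames and traces *)

Section Frames.
Variables (V : topologicalType) (disp : Order.disp_t).
Variable Omega : V -> preorderType disp.
Implicit Types U W T : set V.

Lemma frame_mem_irrelevance U (x : frame Omega U) v (vU vU' : v \in U) :
  x (exist _ v vU) = x (exist _ v vU').
Proof. by rewrite (bool_irrelevance vU vU'). Qed.

Lemma frame_proj_id U (sUU : U `<=` U) (x : frame Omega U) :
  frame_proj sUU x = x.
Proof.
apply: functional_extensionality_dep => -[v vU].
by rewrite /frame_proj /=; exact: (frame_mem_irrelevance x).
Qed.

Lemma frame_proj_comp U W T (sUW : U `<=` W) (sWT : W `<=` T) (sUT : U `<=` T)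
    (x : frame Omega T) :
  frame_proj sUW (frame_proj sWT x) = frame_proj sUT x.
Proof.
by apply: functional_extensionality_dep => v; exact: (frame_mem_irrelevance x).
Qed.

(** Keeping [T] a parameter inside the union lets one gluing serve both amalgamation, where [T] is
    the join of two opens, and extension, where [W] is [T] itself. *)
Lemma glue_right_mem U W T (sT : T `<=` U `|` W) v :
  v \in T -> ~ v \in U -> v \in W.
Proof. by move=> /set_mem/sT[/mem_set vU /(_ vU)|/mem_set]. Qed.

(* On the overlap of [U] and [W] the values of [x] prevail. *)
Definition frame_glue U W T (sT : T `<=` U `|` W)
    (x : frame Omega U) (y : frame Omega W) : frame Omega T :=
  fun v => match pselect (val v \in U) with
    | left vU => x (exist _ (val v) vU)
    | right vNU => y (exist _ (val v) (glue_right_mem sT (valP v) vNU))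
    end.

Lemma frame_glue_le U W T (sT : T `<=` U `|` W) x x' y y' :
  (x <= x')%O -> (y <= y')%O ->
  (frame_glue sT x y <= frame_glue sT x' y')%O.
Proof.
move=> /asboolP xx' /asboolP yy'; apply/asboolP => v; rewrite /frame_glue.
case: pselect => vU; first exact: (xx' (exist (fun u => u \in U) _ vU)).
exact: (yy' (exist (fun u => u \in W) _ _)).
Qed.

Lemma frame_proj_gluel U W T (sT : T `<=` U `|` W) (sUT : U `<=` T) x y :
  frame_proj sUT (frame_glue sT x y) = x.
Proof.
apply: functional_extensionality_dep => -[v vU].
rewrite /frame_proj /frame_glue /=.
case: pselect => [vU'|//].
exact: (frame_mem_irrelevance x).
Qed.

Lemma frame_proj_gluer U W T (sT : T `<=` U `|` W) (sWT : W `<=` T)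
    (sU : U `&` W `<=` U) (sW : U `&` W `<=` W) x y :
  frame_proj sU x = frame_proj sW y ->
  frame_proj sWT (frame_glue sT x y) = y.
Proof.
move=> xy; apply: functional_extensionality_dep => -[v vW].
rewrite /frame_proj /frame_glue /=.
case: pselect => [vU|vNU]; last exact: (frame_mem_irrelevance y).
(* On the overlap the glued point reads [x]; the hypothesis at this coordinate turns that value into
   the one of [y]. *)
have vUW : v \in U `&` W by rewrite in_setI vU.
transitivity (frame_proj sU x (exist (fun u => u \in U `&` W) v vUW)).
  exact: (frame_mem_irrelevance x).
by rewrite xy; exact: (frame_mem_irrelevance y).
Qed.

Lemma is_trace_collapse U (s : seq (frame Omega U)) :
  sorted <=%O s -> is_trace (collapse s).
Proof.
move=> s_le; rewrite /is_trace collapse_neq andbT.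
by apply: subseq_sorted (collapse_subseq _) s_le; exact: le_trans.
Qed.

Lemma trace_le U (x : trace Omega U) : sorted <=%O (trace_seq x).
Proof. by case: x => s /= /andP[]. Qed.

Lemma collapse_trace U (x : trace Omega U) : collapse x = x.
Proof. by case: x => s /= /andP[_ /collapse_id]. Qed.

Lemma trace_res_id U (sUU : U `<=` U) (x : trace Omega U) :
  trace_res sUU x = x.
Proof.
apply: val_inj; rewrite /= (eq_map (frame_proj_id sUU)) map_id.
exact: collapse_trace.
Qed.

Lemma trace_res_comp U W T (sUW : U `<=` W) (sWT : W `<=` T) (sUT : U `<=` T)
    (x : trace Omega T) :
  trace_res sUW (trace_res sWT x) = trace_res sUT x.
Proof.
apply: val_inj; rewrite /= collapse_map_collapse -map_comp.
by congr collapse; apply: eq_map => y; exact: frame_proj_comp.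
Qed.

Lemma trace_glue U W T (sT : T `<=` U `|` W) (sUT : U `<=` T) (sWT : W `<=` T)
    (sU : U `&` W `<=` U) (sW : U `&` W `<=` W)
    (x : trace Omega U) (y : trace Omega W) :
  trace_res sU x = trace_res sW y ->
  exists z : trace Omega T, trace_res sUT z = x /\ trace_res sWT z = y.
Proof.
move=> /(congr1 val)/= xy.
have [p [p_le /allP pE px py]] :=
  interleave (@le_refl _ _) (@le_refl _ _) (trace_le x) (trace_le y) xy.
pose glue q := frame_glue sT q.1 q.2.
have glue_le : sorted <=%O (map glue p).
  by apply: homo_sorted p_le => q q' /andP[]; exact: frame_glue_le.
exists (Trace (is_trace_collapse glue_le)).
split; apply: val_inj; rewrite /= collapse_map_collapse -map_comp.
  rewrite -[RHS]collapse_trace -px; congr collapse; apply: eq_map => q.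
  exact: frame_proj_gluel.
(* The right projection recovers the second component only for pairs agreeing on the overlap, hence
   [eq_in_map] with [pE]. *)
rewrite -[RHS]collapse_trace -py; congr collapse; apply/eq_in_map => q /pE/eqP.
exact: frame_proj_gluer.
Qed.

Lemma trace_extend U T (sUT : U `<=` T) (x : trace Omega U) :
  (forall v, inhabited (Omega v)) ->
  exists z : trace Omega T, trace_res sUT z = x.
Proof.
move=> Omega0.
have w : forall v, Omega v.
  move=> v.
  have [|o _] := @cid (Omega v) (fun=> True); last exact: o.
  by case: (Omega0 v) => o; exists o.
(* One fixed point supplies the coordinates outside [U] for all entries, so monotonicity there is
   reflexivity. *)
pose y : frame Omega T := fun v => w (val v).
pose ext x := frame_glue (@subsetUr _ U T) x y.
have ext_le : sorted <=%O (map ext x).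
  apply: homo_sorted (trace_le x) => a b ab.
  by apply: frame_glue_le => //; exact: le_refl.
exists (Trace (is_trace_collapse ext_le)); apply: val_inj.
rewrite /= collapse_map_collapse -map_comp -[RHS]collapse_trace.
congr collapse; rewrite -[RHS]map_id; apply: eq_map => a.
exact: frame_proj_gluel.
Qed.

End Frames.

Theorem theorem2 (V : topologicalType) (disp : Order.disp_t)
    (Omega : V -> preorderType disp)
    (finV : finite_set [set: V])
    (Omega_nonempty : forall v : V, inhabited (Omega v)) :
  tuple_system (@trace_dom V disp Omega) (@trace_tot_res V disp Omega).
Proof.
split.
- by [].
- move=> x U W WU hU hW hW'; congr existT; exact: trace_res_comp.
- by move=> [X x] U /= <- hU; congr existT; exact: trace_res_id.
- move=> [X x] [Y y] U W /= -> -> hx hy.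
  (* Equality of dependent pairs over the same open yields equality of the traces, since equality of
     opens is decidable. *)
  move=> /(@inj_pair2_eq_dec _ (@eq_comparable (opens V))
    (fun U : opens V => trace Omega U) _ _ _) xy.
  have hU : (X <= X `|` Y)%O by exact: leUl.
  have hW : (Y <= X `|` Y)%O by exact: leUr.
  (* The set underlying the join of opens is the union by conversion, so the inclusion asked of [T]
     is reflexivity. *)
  have [z [zx zy]] := trace_glue (T := (X `|` Y)%O)
    (@subset_refl _ _) (elimT (opens_leP _ _) hU) (elimT (opens_leP _ _) hW) xy.
  exists (existT (fun U : opens V => trace Omega U) (X `|` Y)%O z), hU, hW.
  by split=> //; congr existT.
- move=> [X x] U W /= <- XW.
  have [z zx] := trace_extend (elimT (opens_leP _ _) XW) x Omega_nonempty.
  exists (existT (fun U : opens V => trace Omega U) W z), XW.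
  by split=> //; congr existT.
Qed.
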